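(* Let $(\Omega,\mathcal{B},P)$ be a probability space with $\mathcal{B}$ countably generated, let $\mathcal{A}\subset\mathcal{B}$ be a sub-$\sigma$-field, and let $\mu$ be a fixed regular conditional distribution for $P$ given $\mathcal{A}$. Let $M=\{Q\in\mathbb{P}:\mu\text{ is a regular conditional distribution for }Q\text{ given }\mathcal{A}\}$. Then $Q$ is an extreme point of $M$ if and only if $Q\in M$ and $Q$ is 0–1 on $\mathcal{A}$, and in that case $Q=\mu(\omega)$ for some $\omega\in\Omega$. Moreover, let $T\in\sigma(\mu)$ be a set with $P(T)=1$ and $\mu(\omega)(\mu=\mu(\omega))=1$ for all $\omega\in T$. Then, for each $\omega\in T$, the following statements are equivalent: (i) $\mu(\omega)(A)\in\{0,1\}$ for all $A\in\mathcal{A}$; (ii) $\mu(\omega)$ is an extreme point of $M$; (iii) $\mu(\omega)\in M$. In particular, the condition (4) there is $A_0\in\mathcal{A}$ with $P(A_0)=1$ and $\mu(\omega)(A)\in\{0,1\}$ for all $A\in\mathcal{A}$ and $\omega\in A_0$ holds if and only if, for some $A_0\in\mathcal{A}$ with $P(A_0)=1$, $\mu(\omega)\in M$ for all $\omega\in A_0$.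
   Context: $\mathbb{P}$ is the set of probability measures on $\mathcal{B}$. For $Q\in\mathbb{P}$, a regular conditional distribution for $Q$ given $\mathcal{A}$ is a map $\mu:\Omega\to\mathbb{P}$ such that, for all $B\in\mathcal{B}$, the function $\mu(B):\omega\mapsto\mu(\omega)(B)$ is a version of $E_Q(I_B\mid\mathcal{A})$, the conditional expectation under $Q$ (in particular it is $\mathcal{A}$-measurable). A $\sigma$-field is countably generated if it is generated by one of its countable subclasses. $\sigma(\mu)$ is the $\sigma$-field on $\Omega$ generated by the functions $\mu(B)$, $B\in\mathcal{B}$. $\{\mu=\mu(\omega)\}$ denotes $\{x\in\Omega:\mu(x)=\mu(\omega)\}$ (equality of measures on $\mathcal{B}$). Since $\mathcal{B}$ is countably generated, this set is in $\sigma(\mu)$ and a set $T$ as in the statement always exists. $Q\in\mathbb{P}$ is 0–1 on $\mathcal{A}$ if $Q(A)\in\{0,1\}$ for all $A\in\mathcal{A}$. An extreme point of $M$ is an element of $M$ which is not of the form $uQ_1+(1-u)Q_2$ with $u\in(0,1)$ and $Q_1\neq Q_2$ in $M$. *)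

(* Defs.v *)
From HB Require Import structures.
From mathcomp Require Import all_boot all_order all_algebra.
From mathcomp Require Import all_classical all_reals all_analysis measurable_realfun.

Set Implicit Arguments.
Unset Strict Implicit.
Unset Printing Implicit Defensive.

Import Order.TTheory GRing.Theory Num.Theory.

Local Open Scope classical_set_scope.
Local Open Scope ring_scope.
Local Open Scope ereal_scope.

Definition sub_sigma_field (d : measure_display) (Omega : measurableType d)
    (A : set (set Omega)) : Prop :=
  sigma_algebra [set: Omega] A /\ A `<=` measurable.

Definition countably_generated (T : Type) (F : set (set T)) : Prop :=
  exists C : set (set T), [/\ C `<=` F, countable C & <<s C >> = F].

(* A term of type [probability Omega R] is a function on all subsets of Omega,
   with arbitrary values on non-measurable ones, so equality of probability
   measures on the sigma-field is agreement on measurable sets, not [=]. *)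
Definition same_prob (d : measure_display) (Omega : measurableType d)
    (R : realType) (Q1 Q2 : probability Omega R) : Prop :=
  forall B : set Omega, measurable B -> Q1 B = Q2 B.

Definition cond_expectation_version (d : measure_display)
    (Omega : measurableType d) (R : realType) (Q : probability Omega R)
    (A : set (set Omega)) (X Y : Omega -> \bar R) : Prop :=
  [/\ measurable_fun setT (Y : g_sigma_algebraType A -> \bar R),
      Q.-integrable [set: Omega] Y
    & forall A0 : set Omega, A A0 ->
        \int[Q]_(w in A0) Y w = \int[Q]_(w in A0) X w].

Definition regular_cond_distr (d : measure_display)
    (Omega : measurableType d) (R : realType) (Q : probability Omega R)
    (A : set (set Omega)) (mu : Omega -> probability Omega R) : Prop :=
  forall B : set Omega, measurable B ->
    cond_expectation_version Q A (fun w => (\1_B w)%:E) (fun w => mu w B).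

Definition rcd_set (d : measure_display)
    (Omega : measurableType d) (R : realType)
    (A : set (set Omega)) (mu : Omega -> probability Omega R) :
    set (probability Omega R) :=
  [set Q | regular_cond_distr Q A mu].

Definition sigma_of_rcd (d : measure_display)
    (Omega : measurableType d) (R : realType)
    (mu : Omega -> probability Omega R) : set (set Omega) :=
  <<s \bigcup_(B in @measurable d Omega)
        g_sigma_algebra_preimage (fun w => mu w B) >>.

Definition rcd_level_set (d : measure_display)
    (Omega : measurableType d) (R : realType)
    (mu : Omega -> probability Omega R) (w : Omega) : set Omega :=
  [set x | same_prob (mu x) (mu w)].

Definition zero_one_on (d : measure_display)
    (Omega : measurableType d) (R : realType)
    (A : set (set Omega)) (Q : probability Omega R) : Prop :=
  forall A0 : set Omega, A A0 -> Q A0 = 0 \/ Q A0 = 1.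

Definition extreme_point (d : measure_display)
    (Omega : measurableType d) (R : realType)
    (M : set (probability Omega R)) (Q : probability Omega R) : Prop :=
  M Q /\
  ~ exists (u : R) (Q1 Q2 : probability Omega R),
      [/\ (0 < u < 1)%R, M Q1, M Q2, ~ same_prob Q1 Q2
        & forall B : set Omega, measurable B ->
            Q B = u%:E * Q1 B + (1 - u)%:E * Q2 B].

(* Main.v *)
(* If [Q] in [M] is 0-1 on [A], each [mu(B)] is [Q]-a.s. equal to [Q B], and a
   countable pi-system generating the sigma-field upgrades this to
   [Q {mu = Q} = 1].  Any [Q'] in [M] carried by the fiber [{mu = Q}] satisfies
   [Q' B = \int mu(B) dQ' = Q B]; this gives extremality, because both terms of
   a convex decomposition of [Q] are carried by the fiber, and [Q = mu w] for
   any [w] in it.  Conversely, if [0 < Q D < 1] with [D] in [A], then [Q] is a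
   mixture of [Q(. | D)] and [Q(. | ~` D)], both in [M].

   When [Q {mu = Q} = 1], the [Q]-integral of [mu(B)] over [D] in [A] equals
   [Q B * Q D], so [Q] in [M] means [Q (B `&` D) = Q B * Q D] for all [B] and
   [D]: this holds if [Q] is 0-1 on [A], and [B = D] gives the converse.
   Almost every [mu w] is such a [Q], since [mu w D = 1_D w] for [P]-almost every
   [w], simultaneously for countably many [D] in [A]. *)

Require Import Defs.
From HB Require Import structures.
From mathcomp Require Import all_boot all_order all_algebra.
From mathcomp Require Import all_classical all_reals all_analysis measurable_realfun.

Set Implicit Arguments.
Unset Strict Implicit.
Unset Printing Implicit Defensive.

Import Order.TTheory GRing.Theory Num.Theory.

Local Open Scope classical_set_scope.
Local Open Scope ring_scope.
Local Open Scope ereal_scope.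

(** * Countable pi-systems and fibers of a measure-valued map *)

(** Finite intersections of members of [C] are indexed by codes of finite lists of naturals;
    concatenating lists gives closure under intersection. *)
Lemma setI_closed_countable (T : Type) (C : set (set T)) : countable C ->
  exists g : nat -> set T,
    [/\ setI_closed (range g), range g setT & <<s range g >> = <<s C >>].
Proof.
move=> /countable_injP[f finj].
(* The member of [C] with code [n]; with no such member the intersection is empty, so [h n] is the
   whole space. *)
pose h n : set T := \bigcap_(c in [set c | C c /\ f c = n]) c.
have hf c : C c -> h (f c) = c.
  move=> Cc; rewrite /h (_ : [set _ | _] = [set c]) ?bigcap_set1//.
  apply/seteqP; split=> [c' /= [Cc' ff']|_ ->//=].
  by apply: finj; rewrite ?inE.
have hn n : C (h n) \/ h n = setT.
  have [[c [Cc <-]]|nC] := pselect (exists c, C c /\ f c = n).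
    by left; rewrite hf.
  right; apply/seteqP; split=> // x _ c /= Cc.
  by case: nC; exists c.
pose g n : set T :=
  \big[setI/setT]_(i <- odflt [::] (unpickle n : option (seq nat))) h i.
have gE (s : seq nat) : g (pickle s) = \big[setI/setT]_(i <- s) h i.
  by rewrite /g pickleK.
have [CT _ _ CI] := (sigma_algebraP (fun _ _ => @subsetT _ _)).1
  (smallest_sigma_algebra setT C).
exists g; split.
- move=> _ _ [m _ <-] [n _ <-]; rewrite /g -big_cat -gE.
  by eexists.
- by exists (pickle ([::] : seq nat)) => //; rewrite gE big_nil.
- apply/seteqP; split.
    apply: smallest_sub; first exact: smallest_sigma_algebra.
    move=> _ [n _ <-]; apply: big_ind => // i _.
    by case: (hn i) => [|-> //]; exact: sub_sigma_algebra.
  apply: sub_sigma_algebra2 => c Cc; exists (pickle [:: f c]) => //.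
  by rewrite gE big_seq1 hf.
Qed.

(** [rcd_level_set mu w] is the case [Q = mu w]; an arbitrary [Q] is allowed because it is not yet
    known to be a value of [mu]. *)
Definition rcd_fiber (R : realType) (d : measure_display)
    (Omega : measurableType d) (mu : Omega -> probability Omega R)
    (Q : probability Omega R) : set Omega :=
  [set x | same_prob (mu x) Q].

(** Probability measures agreeing on a generating pi-system coincide, so countably many equations
    cut out every fiber. *)
Lemma rcd_fiber_bigcap (R : realType) (d : measure_display)
    (Omega : measurableType d) :
  countably_generated (@measurable d Omega) ->
  exists g : nat -> set Omega, (forall n, measurable (g n)) /\
    forall (mu : Omega -> probability Omega R) Q,
      rcd_fiber mu Q = \bigcap_n [set x | mu x (g n) = Q (g n)].
Proof.
move=> [C [_ /setI_closed_countable[g [gI gT gC]] CE]].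
have gE : measurable = <<s range g >> by rewrite gC CE.
have mg n : measurable (g n).
  by rewrite gE; apply: sub_sigma_algebra; exists n.
exists g; split=> // mu Q; apply/seteqP; split=> [x xQ n _|x xQ B mB].
  exact: xQ.
apply: (measure_unique (range g) (fun=> setT)) => //.
- by rewrite bigcup_const//; exists 0%N.
- by move=> _ [n _ <-]; exact: xQ.
- by move=> k; rewrite /= probability_setT ltry.
Qed.

(** * Null sets and sets of probability one *)

Lemma probability_setI1 (R : realType) (d : measure_display)
    (Omega : measurableType d) (Q : probability Omega R) (B D : set Omega) :
  measurable B -> measurable D -> Q D = 1 -> Q (B `&` D) = Q B.
Proof.
move=> mB mD QD.
have QDC : Q (~` D) = 0 by rewrite probability_setC// QD subee.
rewrite [RHS](measureDI Q mB mD) (@subset_measure0 _ _ _ Q (B `\` D) (~` D))//.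
- by rewrite add0e.
- exact: measurableD.
- exact: measurableC.
Qed.

Lemma probability_bigcap1 (R : realType) (d : measure_display)
    (Omega : measurableType d) (Q : probability Omega R)
    (F : nat -> set Omega) :
  (forall n, measurable (F n)) -> (forall n, Q (F n) = 1) ->
  Q (\bigcap_n F n) = 1.
Proof.
move=> mF QF.
have mI : measurable (\bigcap_n F n) by exact: bigcapT_measurable.
rewrite -[\bigcap_n F n]setCK probability_setC; last exact: measurableC.
have QFC n : Q (~` F n) = 0 by rewrite probability_setC// QF subee.
rewrite setC_bigcap (_ : Q _ = 0) ?sube0//.
apply/negligibleP; first by apply: bigcupT_measurable => n; apply: measurableC.
apply: negligible_bigcup => n.
by apply/negligibleP; [exact: measurableC | exact: QFC].
Qed.

Lemma lt_integral_null (R : realType) (d : measure_display)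
    (Omega : measurableType d) (Q : {measure set Omega -> \bar R})
    (D : set Omega) (f g : Omega -> \bar R) :
  measurable D -> Q.-integrable D f -> Q.-integrable D g ->
  (forall x, D x -> f x < g x) ->
  \int[Q]_(x in D) f x = \int[Q]_(x in D) g x -> Q D = 0.
Proof.
move=> mD intf intg fg fgE.
have intB := integrableB mD intg intf.
have : \int[Q]_(x in D) `|g x - f x| = 0.
  rewrite (eq_integral (fun x => g x - f x)).
    by rewrite integralB// fgE subee// integrable_fin_num.
  by move=> x /set_mem Dx; rewrite gee0_abs// ltW// sube_gt0 fg.
move/(ae_eq_integral_abs Q mD (measurable_int _ intB)) => [N [mN QN DN]].
apply: (@subset_measure0 _ _ _ Q D N) => // x Dx; apply: DN => /= /(_ Dx)/eqP.
by rewrite gt_eqF// sube_gt0 fg.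
Qed.

(** * Sub-sigma-fields and regular conditional distributions *)

Lemma sub_sigma_field_setI (d : measure_display) (Omega : measurableType d)
    (A : set (set Omega)) : sub_sigma_field A -> setI_closed A.
Proof. by case=> /(sigma_algebraP (fun _ _ => @subsetT _ _))[]. Qed.

Lemma sub_sigma_fieldT (d : measure_display) (Omega : measurableType d)
    (A : set (set Omega)) : sub_sigma_field A -> A setT.
Proof. by case=> /(sigma_algebraP (fun _ _ => @subsetT _ _))[]. Qed.

Lemma sub_sigma_fieldC (d : measure_display) (Omega : measurableType d)
    (A : set (set Omega)) : sub_sigma_field A -> setC_closed A.
Proof. by case=> -[_ AC _] _ D /AC; rewrite setTD. Qed.

Lemma sub_sigma_field_bigcap (d : measure_display) (Omega : measurableType d)
    (A : set (set Omega)) (F : nat -> set Omega) :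
  sub_sigma_field A -> (forall n, A (F n)) -> A (\bigcap_n F n).
Proof.
move=> hA AF; rewrite -[\bigcap_n F n]setCK; apply: sub_sigma_fieldC => //.
rewrite setC_bigcap; case: (hA) => -[_ _ AU] _; apply: AU => n.
exact: sub_sigma_fieldC.
Qed.

Lemma rcd_preimage (R : realType) (d : measure_display)
    (Omega : measurableType d) (Q : probability Omega R)
    (A : set (set Omega)) (mu : Omega -> probability Omega R)
    (B : set Omega) (Y : set (\bar R)) :
  sub_sigma_field A -> regular_cond_distr Q A mu -> measurable B ->
  measurable Y -> A [set w | Y (mu w B)].
Proof.
move=> hA hmu mB mY; have [mf _ _] := hmu B mB.
have := mf measurableT Y mY; rewrite setTI.
by rewrite [X in X _ -> _](sigma_algebra_id hA.1).
Qed.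

Lemma rcd_measurable (R : realType) (d : measure_display)
    (Omega : measurableType d) (Q : probability Omega R)
    (A : set (set Omega)) (mu : Omega -> probability Omega R) (B : set Omega) :
  sub_sigma_field A -> regular_cond_distr Q A mu -> measurable B ->
  measurable_fun setT (fun w => mu w B).
Proof.
move=> hA hmu mB _ Y mY; rewrite setTI.
by apply: hA.2; exact: rcd_preimage hmu mB mY.
Qed.

Lemma rcd_integral (R : realType) (d : measure_display)
    (Omega : measurableType d) (Q : probability Omega R)
    (A : set (set Omega)) (mu : Omega -> probability Omega R)
    (B D : set Omega) :
  sub_sigma_field A -> regular_cond_distr Q A mu -> measurable B -> A D ->
  \int[Q]_(w in D) mu w B = Q (B `&` D).
Proof.
move=> hA hmu mB AD; have [_ _ ->//] := hmu B mB.
by rewrite integral_indic//; exact: hA.2.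
Qed.

Lemma probability_le1_integrable (R : realType) (d : measure_display)
    (Omega : measurableType d) (Q : probability Omega R)
    (mu : Omega -> probability Omega R) (B D : set Omega) :
  measurable_fun setT (fun w => mu w B) -> measurable B -> measurable D ->
  Q.-integrable D (fun w => mu w B).
Proof.
move=> mf mB mD; apply: (@integrableS _ _ _ _ setT) => //.
apply: (@le_integrable _ _ _ _ _ _ _ (EFin \o cst 1%R)) => //.
  by move=> x _ /=; rewrite gee0_abs// normr1 probability_le1.
exact: finite_measure_integrable_cst.
Qed.

(** Measurability with respect to [A] does not involve the measure and passes from [P] to [Q];
    integrability follows from the bound 1. Only the integral identity depends on [Q]. *)
Lemma rcd_change (R : realType) (d : measure_display)
    (Omega : measurableType d) (P Q : probability Omega R)
    (A : set (set Omega)) (mu : Omega -> probability Omega R) :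
  sub_sigma_field A -> regular_cond_distr P A mu ->
  (forall B D, measurable B -> A D ->
     \int[Q]_(w in D) mu w B = Q (B `&` D)) ->
  regular_cond_distr Q A mu.
Proof.
move=> hA hmu QE B mB; have [mf _ _] := hmu B mB; split=> //.
  by apply: probability_le1_integrable => //; exact: rcd_measurable hmu mB.
by move=> D AD; rewrite integral_indic ?QE//; exact: hA.2.
Qed.

(** * Measures carried by a fiber *)

Lemma rcd_fiber_sub_sigma_field (R : realType) (d : measure_display)
    (Omega : measurableType d) (P Q : probability Omega R)
    (A : set (set Omega)) (mu : Omega -> probability Omega R) :
  countably_generated (@measurable d Omega) -> sub_sigma_field A ->
  regular_cond_distr P A mu -> A (rcd_fiber mu Q).
Proof.
move=> /(rcd_fiber_bigcap R)[g [mg fiberE]] hA hmu.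
rewrite fiberE; apply: sub_sigma_field_bigcap => // n.
exact: (rcd_preimage (Y := [set Q (g n)]) hA hmu).
Qed.

(** On the fiber the integrand is the constant [Q B], and [Q'] does not charge the complement. *)
Lemma integral_rcd_fiber (R : realType) (d : measure_display)
    (Omega : measurableType d) (Q Q' : probability Omega R)
    (mu : Omega -> probability Omega R) (B D : set Omega) :
  measurable_fun setT (fun w => mu w B) -> measurable B -> measurable D ->
  measurable (rcd_fiber mu Q) -> Q' (rcd_fiber mu Q) = 1 ->
  \int[Q']_(w in D) mu w B = Q B * Q' D.
Proof.
move=> mf mB mD mF QF; rewrite -integral_cst//.
apply: ge0_ae_eq_integral => //; first exact: measurable_funS mf.
exists (~` rcd_fiber mu Q); split.
- exact: measurableC.
- by rewrite [LHS]probability_setC// QF subee.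
- move=> x /= xB xF; apply: xB => _; exact: xF.
Qed.

Lemma zero_one_rcd_fiber (R : realType) (d : measure_display)
    (Omega : measurableType d) (Q : probability Omega R)
    (A : set (set Omega)) (mu : Omega -> probability Omega R) :
  countably_generated (@measurable d Omega) -> sub_sigma_field A ->
  regular_cond_distr Q A mu -> zero_one_on A Q -> Q (rcd_fiber mu Q) = 1.
Proof.
move=> /(rcd_fiber_bigcap R)[g [mg fiberE]] hA hmu h01.
have mf B := rcd_measurable hA hmu (B := B).
(* If [Q D = 1], both [mu(B)] and the constant [Q B] integrate to [Q B] over [D], which a strict
   inequality on [D] forbids unless [D] is null. *)
have null B (D : set Omega) : measurable B -> A D ->
    (forall x, D x -> mu x B < Q B) \/ (forall x, D x -> Q B < mu x B) ->
    Q D = 0.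
  move=> mB AD DB; have mD := hA.2 _ AD.
  case: (h01 _ AD) => // QD.
  have intB : Q.-integrable D (fun x => mu x B).
    by apply: probability_le1_integrable => //; exact: mf.
  have intQ : Q.-integrable D (cst (Q B)).
    rewrite -(fineK (fin_num_measure Q B mB)).
    exact: finite_measure_integrable_cst.
  have intE : \int[Q]_(x in D) mu x B = \int[Q]_(x in D) cst (Q B) x.
    rewrite integral_cst// (rcd_integral hA hmu)// probability_setI1//.
    by rewrite [X in _ = _ * X]QD mule1.
  by case: DB => DB; [apply: lt_integral_null intB intQ _ _ |
                      apply: lt_integral_null intQ intB _ _].
rewrite fiberE; apply: probability_bigcap1 => n.
  exact/hA.2/(rcd_preimage (Y := [set Q (g n)]) hA hmu).
(* The complement of the level set at [g n] splits into two sets of [A], each with a strict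
   inequality of constant direction. *)
pose Dl := [set w | mu w (g n) < Q (g n)].
pose Dr := [set w | Q (g n) < mu w (g n)].
have ADl : A Dl.
  apply: (rcd_preimage (Y := [set y | y < Q (g n)]) hA hmu) => //.
  by rewrite -[X in measurable X]setTI; exact: emeasurable_fun_infty_o.
have ADr : A Dr.
  apply: (rcd_preimage (Y := [set y | Q (g n) < y]) hA hmu) => //.
  by rewrite -[X in measurable X]setTI; exact: emeasurable_fun_o_infty.
rewrite (_ : [set _ | _] = ~` (Dl `|` Dr)).
  rewrite probability_setC; last by apply: measurableU; exact: hA.2.
  rewrite (_ : Q (Dl `|` Dr) = 0) ?sube0// measureU0//.
  - by apply: (null (g n)) => //; left.
  - exact: hA.2.
  - exact: hA.2.
  - by apply: (null (g n)) => //; right.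
apply/seteqP; split=> x /=; rewrite /Dl /Dr /=.
  by move=> -> []; rewrite ltxx.
by case: (ltgtP (mu x (g n)) (Q (g n))) => // _ []; [left|right].
Qed.

(** For a measure carried by its own fiber, both sides amount to independence of [A] from the whole
    sigma-field. *)
Lemma rcd_fiber_zero_oneP (R : realType) (d : measure_display)
    (Omega : measurableType d) (P Q : probability Omega R)
    (A : set (set Omega)) (mu : Omega -> probability Omega R) :
  countably_generated (@measurable d Omega) -> sub_sigma_field A ->
  regular_cond_distr P A mu -> Q (rcd_fiber mu Q) = 1 ->
  zero_one_on A Q <-> regular_cond_distr Q A mu.
Proof.
move=> hB hA hmu QF.
have mF := hA.2 _ (rcd_fiber_sub_sigma_field Q hB hA hmu).
have QE B D : measurable B -> A D -> \int[Q]_(w in D) mu w B = Q B * Q D.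
  move=> mB AD; apply: integral_rcd_fiber => //; last exact: hA.2.
  exact: rcd_measurable hmu mB.
split=> [h01|hQ D AD].
  apply: (rcd_change hA hmu) => B D mB AD; rewrite QE//.
  have mD := hA.2 _ AD; case: (h01 _ AD) => QD.
    rewrite QD mule0; apply/esym.
    by apply: (@subset_measure0 _ _ _ Q _ D) => //; exact: measurableI.
  by rewrite QD mule1 probability_setI1.
have mD := hA.2 _ AD.
(* Independence of [D] from itself: [Q D] is a root of [x = x * x]. *)
have := QE D D mD AD; rewrite (rcd_integral hA hQ)// setIid.
rewrite -(fineK (fin_num_measure Q D mD)) -EFinM => -[].
move=> /eqP; rewrite -subr_eq0 -[X in (X - _)%R]mulr1 -mulrBr mulf_eq0 subr_eq0.
by move=> /orP[/eqP ->|/eqP <-]; [left|right].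
Qed.

(** * Extremality and the 0-1 property *)

Lemma zero_one_extreme_point (R : realType) (d : measure_display)
    (Omega : measurableType d) (Q : probability Omega R)
    (A : set (set Omega)) (mu : Omega -> probability Omega R) :
  countably_generated (@measurable d Omega) -> sub_sigma_field A ->
  regular_cond_distr Q A mu -> zero_one_on A Q ->
  extreme_point (rcd_set A mu) Q.
Proof.
move=> hB hA hQ h01; split=> // -[u [Q1 [Q2 [/andP[u0 u1] hQ1 hQ2 neq QE]]]].
have QF := zero_one_rcd_fiber hB hA hQ h01.
have mF := hA.2 _ (rcd_fiber_sub_sigma_field Q hB hA hQ).
have sameQ (Q' : probability Omega R) : regular_cond_distr Q' A mu ->
    Q' (~` rcd_fiber mu Q) = 0 -> same_prob Q' Q.
  move=> hQ' Q'F B mB.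
  rewrite -[B in LHS]setIT -(rcd_integral hA hQ')//; last first.
    exact: sub_sigma_fieldT.
  rewrite (integral_rcd_fiber (Q := Q))//.
  - by rewrite [X in _ * X]probability_setT mule1.
  - exact: rcd_measurable hQ mB.
  - rewrite -[rcd_fiber _ _]setCK probability_setC ?Q'F ?sube0//.
    exact: measurableC.
have mFC := measurableC mF.
(* The complement of the fiber is [Q]-null and both weights are positive, so it is null for [Q1] and
   [Q2]; [sameQ] then identifies both with [Q]. *)
have : u%:E * Q1 (~` rcd_fiber mu Q) + (1 - u)%:E * Q2 (~` rcd_fiber mu Q) = 0.
  by rewrite -QE// probability_setC// QF subee.
move=> /eqP; rewrite padde_eq0; last 2 first.
- by apply: mule_ge0 => //; rewrite lee_fin ltW.
- by apply: mule_ge0 => //; rewrite lee_fin subr_ge0 ltW.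
rewrite !mule_eq0 !eqe subr_eq0 (gt_eqF u0) (gt_eqF u1)/=.
move=> /andP[/eqP Q1F /eqP Q2F]; apply: neq => B mB.
by rewrite (sameQ Q1)// (sameQ Q2).
Qed.

(** This measure is the conditional probability given [D]. The last argument of [mnormalize] is a
    default for zero or infinite mass, excluded here. *)
Lemma mnormalize_mrestrE (R : realType) (d : measure_display)
    (Omega : measurableType d) (Q : probability Omega R) (D B : set Omega)
    (mD : measurable D) :
  Q D != 0 ->
  (mnormalize (mrestr Q mD) Q : probability Omega R) B =
  Q (B `&` D) * (fine (Q D))^-1%:E.
Proof.
move=> QD0; rewrite -[LHS]/(mnormalize (mrestr Q mD) Q B).
rewrite /mnormalize/= /mrestr setTI (negbTE QD0)/=.
by rewrite lt_eqF// -ge0_fin_numE// fin_num_measure.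
Qed.

(** Integrating over [E] under the conditional measure is integrating over [E] intersected with [D],
    again in [A], under [Q] scaled by the inverse of [Q D]. *)
Lemma rcd_mnormalize_mrestr (R : realType) (d : measure_display)
    (Omega : measurableType d) (Q : probability Omega R)
    (A : set (set Omega)) (mu : Omega -> probability Omega R) (D : set Omega)
    (mD : measurable D) :
  sub_sigma_field A -> regular_cond_distr Q A mu -> A D -> Q D != 0 ->
  regular_cond_distr (mnormalize (mrestr Q mD) Q) A mu.
Proof.
move=> hA hQ AD QD0; apply: (rcd_change hA hQ) => B E mB AE.
have mE := hA.2 _ AE; have mf := rcd_measurable hA hQ mB.
have AED : A (E `&` D) by exact: sub_sigma_field_setI.
have mED := hA.2 _ AED.
have c0 : (0 <= (fine (Q D))^-1)%R by rewrite invr_ge0 fine_ge0.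
rewrite mnormalize_mrestrE//.
rewrite (@ge0_negligible_integral _ _ _ _ E (~` D))//; last 3 first.
- exact: measurableC.
- exact: measurable_funS mf.
- by rewrite [LHS]mnormalize_mrestrE// setICl measure0 mul0e.
rewrite setDE setCK.
rewrite (eq_measure_integral (mscale (NngNum c0) Q)).
  rewrite ge0_integral_mscale//; last exact: measurable_funS mf.
  by rewrite (rcd_integral hA hQ)// setIA muleC.
move=> F mF FED; rewrite [LHS]mnormalize_mrestrE// muleC.
by rewrite (setIidl (subset_trans FED (@subIsetr _ _ _))).
Qed.

Lemma extreme_point_zero_one (R : realType) (d : measure_display)
    (Omega : measurableType d) (Q : probability Omega R)
    (A : set (set Omega)) (mu : Omega -> probability Omega R) :
  sub_sigma_field A -> extreme_point (rcd_set A mu) Q -> zero_one_on A Q.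
Proof.
move=> hA [hQ nQ] D AD; have mD := hA.2 _ AD; have mDC := measurableC mD.
have ADC := sub_sigma_fieldC hA AD.
have [/eqP|QD0] := boolP (Q D == 0); first by left.
have [/eqP QDC0|QDC0] := boolP (Q (~` D) == 0).
  by right; rewrite -[D]setCK probability_setC// QDC0 sube0.
exfalso; apply: nQ.
have QDfin := fin_num_measure Q D mD.
have QDCE : Q (~` D) = (1 - fine (Q D))%:E.
  by rewrite probability_setC// EFinB fineK.
have u0 : (0 < fine (Q D))%R.
  by rewrite fine_gt0// lt0e QD0 measure_ge0/= -ge0_fin_numE.
have u1 : (fine (Q D) < 1)%R.
  by rewrite -subr_gt0 -lte_fin -QDCE lt0e QDC0 measure_ge0.
(* Law of total probability with weight [Q D]; the two conditional measures differ at [D], where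
   only the second vanishes. *)
exists (fine (Q D)), (mnormalize (mrestr Q mD) Q),
  (mnormalize (mrestr Q mDC) Q); split.
- by rewrite u0 u1.
- exact: rcd_mnormalize_mrestr.
- exact: rcd_mnormalize_mrestr.
- move=> /(_ D mD); rewrite !mnormalize_mrestrE// setIid setICr measure0 mul0e.
  by move=> /eqP; rewrite mule_eq0 (negbTE QD0)/= eqe invr_eq0 gt_eqF.
- move=> B mB; rewrite !mnormalize_mrestrE// QDCE/=.
  rewrite !(muleC (_%:E)) -!muleA -!EFinM !mulVf ?mule1; last 2 first.
  + by rewrite gt_eqF// subr_gt0.
  + by rewrite gt_eqF.
  by rewrite (measureDI Q mB mD) setDE addeC.
Qed.

(** * Almost every [mu w] is carried by its fiber *)

(** The set lies in [A] and inside [D], so the mass [mu w] gives to the complement of [D] integrates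
    to 0 over it although it is positive there. *)
Lemma rcd_setC_null (R : realType) (d : measure_display)
    (Omega : measurableType d) (P : probability Omega R)
    (A : set (set Omega)) (mu : Omega -> probability Omega R) (D : set Omega) :
  sub_sigma_field A -> regular_cond_distr P A mu -> A D ->
  P (D `&` [set w | 0 < mu w (~` D)]) = 0.
Proof.
move=> hA hmu AD; have mD := hA.2 _ AD; have mDC := measurableC mD.
set N := _ `&` _.
have AN : A N.
  apply: sub_sigma_field_setI => //.
  apply: (rcd_preimage (Y := [set y | 0 < y]) hA hmu) => //.
  by rewrite -[X in measurable X]setTI; exact: emeasurable_fun_o_infty.
have mN := hA.2 _ AN.
apply: (@lt_integral_null _ _ _ P N (cst 0) (fun w => mu w (~` D))) => //.
- exact: integrable0.
- by apply: probability_le1_integrable => //; exact: rcd_measurable hmu mDC.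
- by move=> x [].
- rewrite integral0 (rcd_integral hA hmu)//.
  by rewrite (_ : ~` D `&` N = set0) ?measure0// setIA setICl set0I.
Qed.

(* If every [D = {mu(g n) <= q}], [q] rational, satisfies [mu w D = 1_D w],
   then [mu w] is carried by the fiber through [w]. *)
Lemma rcd_fiber_ae (R : realType) (d : measure_display)
    (Omega : measurableType d) (P : probability Omega R)
    (A : set (set Omega)) (mu : Omega -> probability Omega R) :
  countably_generated (@measurable d Omega) -> sub_sigma_field A ->
  regular_cond_distr P A mu ->
  exists T : set Omega, [/\ A T, P T = 1 &
    forall w, T w -> mu w (rcd_fiber mu (mu w)) = 1].
Proof.
move=> /(rcd_fiber_bigcap R)[g [mg fiberE]] hA hmu.
(* An enumeration of the rationals; codes that decode to nothing give 0. *)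
pose q k : R := ratr (odflt 0%R (unpickle k : option rat)).
pose D n k := [set x | mu x (g n) <= (q k)%:E].
have AD n k : A (D n k).
  apply: (rcd_preimage (Y := [set y | y <= (q k)%:E]) hA hmu) => //.
  by rewrite -[X in measurable X]setTI; exact: emeasurable_fun_infty_c.
have ADC n k := sub_sigma_fieldC hA (AD n k).
pose N E := E `&` [set w | 0 < mu w (~` E)].
have AN E : A E -> A (N E).
  move=> AE; apply: sub_sigma_field_setI => //.
  apply: (rcd_preimage (Y := [set y | 0 < y]) hA hmu) => //.
    exact/measurableC/hA.2.
  by rewrite -[X in measurable X]setTI; exact: emeasurable_fun_o_infty.
have PNC E : A E -> P (~` N E) = 1.
  move=> AE; rewrite probability_setC; last exact/hA.2/AN.
  by rewrite (rcd_setC_null hA hmu)// sube0.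
(* Excluding the bad points of each [D n k] and of its complement makes [mu w] give mass 1 to
   whichever of the two contains [w]. *)
pose T := \bigcap_n \bigcap_k (~` N (D n k) `&` ~` N (~` D n k)).
have AT1 n k : A (~` N (D n k) `&` ~` N (~` D n k)).
  apply: sub_sigma_field_setI => //;
    by apply: sub_sigma_fieldC => //; exact: AN.
exists T; split.
- by apply: sub_sigma_field_bigcap => // n; exact: sub_sigma_field_bigcap.
- apply: probability_bigcap1 => n.
    by apply: hA.2; exact: sub_sigma_field_bigcap.
  apply: probability_bigcap1 => k; first exact: hA.2.
  rewrite probability_setI1 ?PNC//; try exact: sub_sigma_fieldC.
  + by apply/measurableC/hA.2/AN.
  + by apply/measurableC/hA.2/AN.
move=> w Tw.
have mE n : A [set x | mu x (g n) = mu w (g n)].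
  exact: (rcd_preimage (Y := [set mu w (g n)]) hA hmu).
rewrite fiberE; apply: probability_bigcap1 => n; first exact: hA.2.
(* Two reals are equal exactly when no rational threshold separates them. *)
rewrite (_ : [set _ | _] =
    \bigcap_k [set x | D n k x <-> D n k w]); last first.
  apply/seteqP; split=> [x xw k _ /=|x xD /=]; first by rewrite /D /= xw.
  have fx := fin_num_measure (mu x) (g n) (mg n).
  have fw := fin_num_measure (mu w) (g n) (mg n).
  have {}xD k : (fine (mu x (g n)) <= q k)%R <-> (fine (mu w (g n)) <= q k)%R.
    by rewrite -!lee_fin !fineK//; exact: (xD k I).
  rewrite -(fineK fx) -(fineK fw).
  have qP (a b : R) : (a < b)%R -> exists k, (a < q k < b)%R.
    move=> /rat_in_itvoo[r]; rewrite in_itv/= => rab.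
    by exists (pickle r); rewrite /q pickleK.
  case: (ltgtP (fine (mu x (g n))) (fine (mu w (g n)))) => [||->//].
    by move=> /qP[k /andP[/ltW/xD]]; rewrite leNgt => /negP.
  by move=> /qP[k /andP[/ltW/xD]]; rewrite leNgt => /negP.
have carried E : A E -> E w -> ~ N E w -> mu w E = 1.
  move=> AE Ew nN; rewrite -[E]setCK probability_setC; last first.
    exact/measurableC/hA.2.
  rewrite (_ : mu w (~` E) = 0) ?sube0//.
  apply/eqP; apply: contrapT => /negP E0; apply: nN; split=> //=.
  by rewrite lt0e E0 measure_ge0.
have levelE k : [set x | D n k x <-> D n k w] = D n k /\ D n k w \/
    [set x | D n k x <-> D n k w] = ~` D n k /\ ~ D n k w.
  have [Dw|nDw] := pselect (D n k w); [left|right]; split=> //.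
    by apply/seteqP; split=> x /=; tauto.
  by apply/seteqP; split=> x /=; tauto.
apply: probability_bigcap1 => k.
  by case: (levelE k) => -[-> _]; exact: hA.2.
have [nN nNC] := Tw n I k I.
by case: (levelE k) => -[-> ?]; exact: carried.
Qed.

(** * Extreme points of [M] and membership of [mu w] in [M] *)

Theorem theorem12 (R : realType) (d : measure_display)
    (Omega : measurableType d) (P : probability Omega R)
    (hB : countably_generated (@measurable d Omega))
    (A : set (set Omega)) (hA : sub_sigma_field A)
    (mu : Omega -> probability Omega R)
    (hmu : regular_cond_distr P A mu) :
  [/\ forall Q : probability Omega R,
        (extreme_point (rcd_set A mu) Q <->
           rcd_set A mu Q /\ zero_one_on A Q) /\
        (extreme_point (rcd_set A mu) Q ->
           exists w : Omega, same_prob Q (mu w)),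
      forall T : set Omega,
        sigma_of_rcd mu T -> P T = 1 ->
        (forall w : Omega, T w -> mu w (rcd_level_set mu w) = 1) ->
        forall w : Omega, T w ->
          [<-> zero_one_on A (mu w);
               extreme_point (rcd_set A mu) (mu w);
               rcd_set A mu (mu w)]
    & (exists A0 : set Omega, [/\ A A0, P A0 = 1
         & forall w : Omega, A0 w -> zero_one_on A (mu w)]) <->
      (exists A0 : set Omega, [/\ A A0, P A0 = 1
         & forall w : Omega, A0 w -> rcd_set A mu (mu w)])].
Proof.
have fib Q : rcd_set A mu Q -> zero_one_on A Q -> Q (rcd_fiber mu Q) = 1.
  exact: zero_one_rcd_fiber.
have ext Q : rcd_set A mu Q -> zero_one_on A Q ->
    extreme_point (rcd_set A mu) Q.
  exact: zero_one_extreme_point.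
split.
- move=> Q; split.
    split=> [eQ|[]]; last exact: ext.
    by split; [exact: eQ.1 | exact: extreme_point_zero_one eQ].
  move=> eQ; apply: contrapT => nQ.
  have := fib Q eQ.1 (extreme_point_zero_one hA eQ).
  (* A [Q] that is no value of [mu] would have an empty fiber, against its mass 1. *)
  rewrite (_ : rcd_fiber mu Q = set0) ?measure0.
    by move/eqP; rewrite eqe eq_sym oner_eq0.
  apply/seteqP; split=> // x xQ; apply: nQ; exists x => B mB.
  by rewrite xQ.
- move=> T _ _ hT w Tw.
  have iff := rcd_fiber_zero_oneP hB hA hmu (hT w Tw).
  tfae.
  + by move=> h01; apply: ext => //; exact/iff.
  + by case.
  + by move=> /iff.
- have [T [AT PT hT]] := rcd_fiber_ae hB hA hmu.
  have iff w (Tw : T w) := rcd_fiber_zero_oneP hB hA hmu (hT w Tw).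
  (* Shrinking [A0] to its part in [T] keeps probability 1 and makes the pointwise equivalence
     available. *)
  have AT0 A0 : A A0 -> P A0 = 1 -> A (A0 `&` T) /\ P (A0 `&` T) = 1.
    move=> AA0 PA0; split; first exact: sub_sigma_field_setI.
    by rewrite probability_setI1//; exact: hA.2.
  by split=> -[A0 [AA0 PA0 hA0]]; exists (A0 `&` T);
    have [AI PI] := AT0 A0 AA0 PA0; split=> // w [A0w Tw];
    apply/(iff w Tw)/hA0.
Qed.
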